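(* For each real $\epsilon$ with $0.134<\epsilon<\frac12$, as $x\to\infty$, $${\sum_{n\le x}}^{\prime} a_n=\frac{x^2}{\pi^2}\log x+\frac{1}{6\pi^2}\left(-\frac{36\,\zeta'(2)}{\pi^2}+A\right)x^2+O_\epsilon\left(x^{\frac32+\epsilon}\log^2 x\right),$$ where $A=12\gamma-3+10\log 2$, and $\gamma$ denotes Euler's constant.
   Context: For a positive integer $n$, define $a_n=\sum_{d\mid n} d\,\phi(n/d)$ if $n$ is odd and $a_n=0$ if $n$ is even, where the sum is over positive divisors $d$ of $n$ and $\phi$ is Euler's totient function (with $\phi(1)=1$). $\zeta$ is the Riemann zeta function and $\zeta'$ its derivative. The prime on the summation sign indicates that if $x$ is an integer, the last term $a_x$ is counted with weight $\frac12$, i.e. only $\frac12 a_x$ is counted. The implied constant in $O_\epsilon$ may depend on $\epsilon$. *)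

(* Defs.v *)
From HB Require Import structures.
From mathcomp Require Import all_boot all_order all_algebra.
From mathcomp Require Import all_classical all_reals all_analysis.

Set Implicit Arguments.
Unset Strict Implicit.
Unset Printing Implicit Defensive.

Import Order.TTheory GRing.Theory Num.Theory.
Import numFieldNormedType.Exports.

Local Open Scope classical_set_scope.
Local Open Scope ring_scope.

Definition a_seq (n : nat) : nat :=
  if odd n then (\sum_(d <- divisors n) d * totient (n %/ d))%N else 0%N.

(* The restriction of the Riemann zeta function to the real half-line s > 1,
   where it is the sum of its Dirichlet series (no meaning for s <= 1). Its
   real derivative at a point s > 1 is the value of the complex derivative. *)
Definition zeta {R : realType} (s : R) : R :=
  limn (fun n : nat => \sum_(1 <= k < n.+1) k%:R `^ (- s)).

Definition euler_gamma {R : realType} : R :=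
  limn (fun n : nat => (\sum_(1 <= k < n.+1) k%:R^-1) - ln n%:R : R).

(* Sum of u n over the integers 1 <= n <= x, where the term n = x, present only
   if x is an integer, has weight 1/2. *)
Definition primed_sum {R : realType} (u : nat -> R) (x : R) : R :=
  \sum_(1 <= n < (Num.truncn x).+1) (if n%:R == x then u n / 2 else u n).

(* The Landau notations require their filter to be a canonical filter_on. *)
Canonical pinfty_filter_on (R : numFieldType) : filter_on R :=
  FilterType (pinfty_nbhs R) _.

(* Main.v *)
Require Import Defs.
From HB Require Import structures.
From mathcomp Require Import all_boot all_order all_algebra.
From mathcomp Require Import cyclic.
From mathcomp Require Import all_classical all_reals all_analysis.
From mathcomp Require Import zify ring lra.

Import Order.TTheory GRing.Theory Num.Theory.
Import numFieldNormedType.Exports.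

Local Open Scope classical_set_scope.
Local Open Scope ring_scope.

(** Write a(n) for the summand, A(x) for its sum over n <= x, and work with
    odd integers only.  Since a is the Dirichlet convolution of the identity
    and phi, and the convolution of phi with 1 is the identity, summing A over
    the odd dilations of x gives an elementary sum:
      sum_(k odd <= x) A(x/k) = T(x) := sum_(ab <= x, a and b odd) ab
    ([sum_pillai_sum]).  Dirichlet's hyperbola method ([sum_hyperbola]) and the
    expansion of the odd harmonic sums give, with g Euler's constant,
      T(x) = x^2/8 ln x + (g/4 + ln 2/4 - 1/16) x^2 + O(x^(3/2))
    ([weighted_odd_sum_asymp]).

    A model B(x) = x^2 (alpha ln x + beta) satisfies the same equation up to
    O(x^(3/2)) as soon as alpha Z0 = 1/8 and
    beta Z0 - alpha Z1 = g/4 + ln 2/4 - 1/16, where Z0 and Z1 are the sums over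
    odd k of 1/k^2 and of ln k/k^2 ([model_sum_asymp]).  Splitting off even
    integers, Z0 = pi^2/8 and Z1 = - 3/4 zeta'(2) - ln 2 pi^2/24, and solving
    for alpha and beta yields exactly the constants of the theorem
    ([pillai_main_const]).  The value of Z0 comes from a finite identity between
    values of 1/sin^2 at dyadic angles ([sum_csc2]), and zeta'(2) is obtained by
    a second order Taylor bound on each term of the Dirichlet series
    ([zeta_taylor]).

    It remains to recover A from its odd dilations.  The difference E = A - B
    satisfies |sum_(k odd <= x) E(x/k)| <= C x^(3/2).  Since the sum of
    k^(-3/2) over odd k >= 3 is at most 1/sqrt 2 < 1, the term k = 1 dominates:
    strong induction on the integer part of x bounds E(x) itself by a multiple
    of x^(3/2) ([odd_inversion_bound]), with no appeal to the Moebius function.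
    Finally the sum with halved last term lies between A(x-1) and A(x), and
    B(x) - B(x-1) is O(x^(3/2)). *)

Set Implicit Arguments.
Unset Strict Implicit.
Unset Printing Implicit Defensive.

(** * Summatory functions of Dirichlet convolutions *)

Lemma sum_dvd_divn {V : nmodType} (g : nat -> V) d N : (0 < d)%N ->
  \sum_(1 <= n < N.+1 | (d %| n)%N) g (n %/ d)%N =
  \sum_(1 <= m < (N %/ d)%N.+1) g m.
Proof.
move=> d0; elim: N => [|N IH]; first by rewrite div0n !big_geq.
rewrite big_mkcond big_nat_recr//= -big_mkcond IH (divnS N d0).
by case: ifP => dN; rewrite ?addr0// [RHS]big_nat_recr// dN.
Qed.

(** Both sides sum f over the pairs (d, m) with d m <= N; on the right they are
    grouped by the value n of the product. *)
Lemma sum_dirichlet {V : nmodType} (f : nat -> nat -> V) N :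
  \sum_(1 <= d < N.+1) \sum_(1 <= m < (N %/ d)%N.+1) f d m =
  \sum_(1 <= n < N.+1) \sum_(d <- divisors n) f d (n %/ d)%N.
Proof.
transitivity (\sum_(1 <= d < N.+1) \sum_(1 <= n < N.+1 | (d %| n)%N)
    f d (n %/ d)%N).
  by apply: eq_big_nat => d /andP[d0 _]; rewrite sum_dvd_divn.
under eq_bigr do rewrite big_mkcond.
rewrite exchange_big/=; apply: eq_big_nat => n /andP[n0 nN].
rewrite -big_mkcond/= -[LHS]big_filter.
apply: perm_big; apply: uniq_perm; rewrite ?filter_uniq ?iota_uniq//.
  exact: divisors_uniq.
move=> d; rewrite mem_filter mem_index_iota -dvdn_divisors//.
apply: andb_idr => dn; rewrite (dvdn_gt0 _ dn)//=.
exact: leq_ltn_trans (dvdn_leq _ dn) nN.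
Qed.

(** The region a b <= N is symmetric in a and b. *)
Lemma sum_hyperbola_swap {V : nmodType} (f : nat -> nat -> V) N :
  \sum_(1 <= a < N.+1) \sum_(1 <= b < (N %/ a)%N.+1) f a b =
  \sum_(1 <= b < N.+1) \sum_(1 <= a < (N %/ b)%N.+1) f a b.
Proof.
have H (g : nat -> nat -> V) :
    \sum_(1 <= a < N.+1) \sum_(1 <= b < (N %/ a)%N.+1) g a b =
    \sum_(1 <= a < N.+1) \sum_(1 <= b < N.+1)
      if (a * b <= N)%N then g a b else 0.
  apply: eq_big_nat => a /andP[a0 aN].
  rewrite (@big_nat_widen _ _ _ _ _ N.+1) ?ltnS ?leq_div// big_mkcond/=.
  by apply: eq_bigr => b _; rewrite ltnS leq_divRL// mulnC.
rewrite H exchange_big/= H; apply: eq_bigr => b _; apply: eq_bigr => a _.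
by rewrite mulnC.
Qed.

(** [sum_totient_dvd] read through the involution d |-> n / d of the
    divisors. *)
Lemma sum_totient_divisors n : (0 < n)%N ->
  (\sum_(d <- divisors n) totient (n %/ d))%N = n.
Proof.
move=> n0; rewrite -[RHS]sum_totient_dvd -(big_mkord (dvdn^~ n) totient)/=.
rewrite -[RHS]big_filter -(big_map (fun d => n %/ d)%N xpredT totient).
apply: perm_big; apply: uniq_perm; rewrite ?filter_uniq ?iota_uniq//.
  rewrite map_inj_in_uniq ?divisors_uniq// => d e.
  rewrite -!dvdn_divisors// => dn en nde.
  have d0 := dvdn_gt0 n0 dn; have e0 := dvdn_gt0 n0 en.
  have := divnK dn; rewrite nde => h1.
  have := divnK en; rewrite -{2}h1 => /eqP; rewrite eqn_pmul2l; last first.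
    by rewrite divn_gt0// dvdn_leq.
  by move/eqP => ->.
move=> d; rewrite mem_filter mem_index_iota/=.
apply/mapP/idP => [[e]|/andP[dn _]].
  rewrite -dvdn_divisors// => en ->.
  rewrite ltnS leq_div andbT.
  by apply/dvdnP; exists e; rewrite mulnC divnK.
exists (n %/ d)%N; last by rewrite divnA// mulKn.
by rewrite -dvdn_divisors//; apply/dvdnP; exists d; rewrite mulnC divnK.
Qed.

Section Arithmetic.
Variable R : realType.
Implicit Types N M U : nat.

Definition pillai_sum N : R := \sum_(1 <= n < N.+1) (a_seq n)%:R.

Definition odd_sum N : R := \sum_(1 <= n < N.+1 | odd n) n%:R.

Definition totient_sum N : R := \sum_(1 <= n < N.+1 | odd n) (totient n)%:R.

Lemma odd_dvdn_div n d : d \in divisors n -> (0 < n)%N ->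
  odd n = odd d && odd (n %/ d)%N.
Proof.
move=> + n0; rewrite -dvdn_divisors// => dn.
by rewrite -{1}(divnK dn) oddM andbC.
Qed.

Lemma pillai_sumE N : pillai_sum N =
  \sum_(1 <= d < N.+1 | odd d) d%:R * totient_sum (N %/ d)%N.
Proof.
rewrite big_mkcond/=.
under [RHS]eq_bigr => d _.
  have -> : (if odd d then d%:R * totient_sum (N %/ d)%N else 0) =
    \sum_(1 <= m < (N %/ d)%N.+1)
      (if odd d && odd m then (d * totient m)%:R else 0 : R).
    case: (odd d) => /=; last by rewrite big1.
    rewrite -big_mkcond/= /totient_sum mulr_sumr.
    by apply: eq_bigr => m _; rewrite natrM.
  over.
rewrite (sum_dirichlet (fun d m =>
  if odd d && odd m then (d * totient m)%:R else 0)).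
apply: eq_big_nat => n /andP[n0 _]; rewrite /a_seq.
case: ifPn => on; last first.
  rewrite big_seq big1// => d dn; rewrite -odd_dvdn_div// ifN//.
rewrite natr_sum [RHS]big_seq big_seq; apply: eq_bigr => d dn.
by rewrite -odd_dvdn_div// on.
Qed.

Lemma sum_totient_sum N :
  \sum_(1 <= k < N.+1 | odd k) totient_sum (N %/ k)%N = odd_sum N.
Proof.
rewrite big_mkcond/=.
under eq_bigr => d _.
  have -> : (if odd d then totient_sum (N %/ d)%N else 0) =
    \sum_(1 <= m < (N %/ d)%N.+1)
      (if odd d && odd m then (totient m)%:R else 0 : R).
    case: (odd d) => /=; last by rewrite big1.
    by rewrite -big_mkcond.
  over.
rewrite (sum_dirichlet (fun d m =>
  if odd d && odd m then (totient m)%:R else 0)).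
rewrite /odd_sum [RHS]big_mkcond/=.
apply: eq_big_nat => n /andP[n0 _].
transitivity (\sum_(d <- divisors n)
    if odd n then (totient (n %/ d)%N)%:R else 0 : R).
  by rewrite [RHS]big_seq big_seq; apply: eq_bigr => d dn; rewrite -odd_dvdn_div.
case: ifP => on; last by rewrite big1.
by rewrite -natr_sum sum_totient_divisors.
Qed.

(** In terms of convolutions this is 1 * (id * phi) = id * id, restricted to odd
    integers: after exchanging the two summations, the inner one is
    1 * phi = id.  It ties the sum to be estimated to an explicit one. *)
Lemma sum_pillai_sum N :
  \sum_(1 <= k < N.+1 | odd k) pillai_sum (N %/ k)%N =
  \sum_(1 <= a < N.+1 | odd a) a%:R * odd_sum (N %/ a)%N.
Proof.
rewrite [LHS]big_mkcond [RHS]big_mkcond/=.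
transitivity (\sum_(1 <= k < N.+1) \sum_(1 <= d < (N %/ k)%N.+1)
  if odd k && odd d then d%:R * totient_sum (N %/ k %/ d)%N else 0).
  apply: eq_bigr => k _; case: (odd k) => /=; last by rewrite big1.
  by rewrite pillai_sumE big_mkcond.
rewrite sum_hyperbola_swap; apply: eq_bigr => d _.
case: (odd d); last by rewrite big1// => k _; rewrite andbF.
rewrite -sum_totient_sum mulr_sumr [RHS]big_mkcond/=.
by apply: eq_bigr => k _; rewrite andbT -!divnMA mulnC.
Qed.

(** Dirichlet's hyperbola method, in the symmetric case.  A pair (a, b) with
    a b <= N has a <= U or b <= U, since N < (U+1)^2, and every pair with both
    a <= U and b <= U has a b <= N, since U^2 <= N: the two families are
    counted with equal contributions, and their intersection is a full
    square. *)
Lemma sum_hyperbola (f : nat -> R) N U :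
  (U ^ 2 <= N)%N -> (N < U.+1 ^ 2)%N ->
  \sum_(1 <= a < N.+1) f a * (\sum_(1 <= b < (N %/ a)%N.+1) f b) =
  2 * (\sum_(1 <= a < U.+1) f a * (\sum_(1 <= b < (N %/ a)%N.+1) f b))
  - (\sum_(1 <= a < U.+1) f a) ^+ 2.
Proof.
move=> UN NU.
pose F M := \sum_(1 <= b < M.+1) f b.
have UleN : (U <= N)%N.
  by apply: leq_trans UN; rewrite -mulnn; case: (U) => // u; rewrite leq_pmulr.
(* The pairs with a > U all have b <= U, so they can be grouped by b. *)
have tail : \sum_(U.+1 <= a < N.+1) f a * F (N %/ a)%N =
    \sum_(1 <= b < U.+1) f b * (F (N %/ b)%N - F U).
  transitivity (\sum_(U.+1 <= a < N.+1) \sum_(1 <= b < U.+1)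
      if (a * b <= N)%N then f a * f b else 0).
    apply: eq_big_nat => a /andP[Ua aN].
    have a0 : (0 < a)%N by exact: leq_trans Ua.
    have NaU : (N %/ a <= U)%N.
      rewrite -ltnS ltn_divLR//; apply: leq_trans NU _.
      by rewrite -mulnn leq_pmul2l.
    rewrite /F (@big_nat_widen _ _ _ _ _ U.+1)// mulr_sumr big_mkcond/=.
    by apply: eq_bigr => b _; rewrite ltnS leq_divRL// mulnC.
  rewrite exchange_big/=; apply: eq_big_nat => b /andP[b0 bU].
  have UNb : (U <= N %/ b)%N.
    rewrite leq_divRL//; apply: leq_trans UN.
    by rewrite -mulnn leq_mul.
  have NbN : (N %/ b <= N)%N by rewrite leq_div.
  have -> : F (N %/ b)%N - F U = \sum_(U.+1 <= a < (N %/ b)%N.+1) f a.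
    by rewrite /F (@big_cat_nat _ _ _ U.+1 1 (N %/ b)%N.+1)//= addrAC subrr add0r.
  rewrite mulr_sumr [RHS](@big_nat_widen _ _ _ _ _ N.+1) ?ltnS// [RHS]big_mkcond/=.
  by apply: eq_bigr => a _; rewrite ltnS leq_divRL// mulrC.
rewrite (big_cat_nat (n := U.+1))//= tail.
under [X in _ + X = _]eq_bigr do rewrite mulrBr.
rewrite sumrB -mulr_suml /F; ring.
Qed.
End Arithmetic.

(** * Tails of series by telescoping *)

Section Telescoping.
Variable R : realType.

Lemma sum_le_telescope (f g : nat -> R) M N : (M <= N)%N ->
  (forall n, (M <= n)%N -> f n.+1 <= g n - g n.+1) ->
  \sum_(M.+1 <= n < N.+1) f n <= g M - g N.
Proof.
move=> + fg; elim: N => [|N IH MN].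
  by rewrite leqn0 => /eqP ->; rewrite big_geq// subrr.
move: MN; rewrite leq_eqVlt ltnS => /predU1P[->|MN].
  by rewrite big_geq// subrr.
rewrite big_nat_recr//=; have := IH MN; have := fg _ MN; lra.
Qed.

End Telescoping.

(** * The sum of the inverse squares of the odd integers *)

Section OddBasel.
Variable R : realType.
Implicit Types (x y : R) (n M N : nat).

Lemma sin_le_id x : 0 <= x <= pi / 2 -> sin x <= x.
Proof.
move=> /andP[x0 xp].
have [|c _] := @MVT_segment R sin cos 0 x x0 (fun y _ => is_derive_sin y).
  by apply: continuous_subspaceT; exact: continuous_sin.
rewrite sin0 !subr0 => ->.
by rewrite ler_piMl ?cos_le1.
Qed.

Lemma id_le_tan x : 0 <= x < pi / 2 -> x <= tan x.
Proof.
move=> /andP[x0 xp].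
have cpos y : 0 <= y <= x -> 0 < cos y.
  by move=> /andP[y0 yx]; apply: cos_gt0_pihalf; apply/andP; split; lra.
have [||c /[!in_itv]/= cx] := @MVT_segment R tan (fun y => cos y ^- 2) 0 x x0.
- move=> y; rewrite in_itv/= => /andP[y0 yx]; apply: is_derive_tan.
  by rewrite gt_eqF// cpos// !ltW.
- apply: continuous_in_subspaceT => y; rewrite inE/= in_itv/= => yx.
  by apply: continuous_tan; rewrite gt_eqF// cpos.
rewrite tan0 !subr0 => ->.
by rewrite ler_peMl// invf_ge1 ?exprn_gt0 ?cpos// expr_le1 ?ltW ?cpos// cos_le1.
Qed.

Definition csc2 x : R := (sin x ^+ 2)^-1.

(** The identity 1/(sin^2 cos^2) = 1/sin^2 + 1/cos^2 at the half angle, with the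
    cosine turned into the sine of the complementary angle so that it can be
    iterated. *)
Lemma csc2_duplication x : 0 < x < pi / 2 ->
  csc2 x = (csc2 (x / 2) + csc2 (pi / 2 - x / 2)) / 4.
Proof.
move=> /andP[x0 xp]; rewrite /csc2.
have -> : sin (pi / 2 - x / 2) = cos (x / 2).
  by rewrite -[_ - _]opprB sinN sinBpihalf opprK.
have c0 : cos (x / 2) != 0.
  by rewrite gt_eqF// cos_gt0_pihalf//; apply/andP; split; lra.
have s0 : sin (x / 2) != 0.
  by rewrite gt_eqF// sin_gt0_pihalf//; apply/andP; split; lra.
have -> : sin x = 2 * (cos (x / 2) * sin (x / 2)).
  by rewrite {1}(splitr x) -mulr2n sin_mulr2n mulr_natl.
rewrite -[LHS]mul1r -{1}(cos2Dsin2 (x / 2)); field.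
by rewrite c0 s0.
Qed.

(** This is sin x <= x <= tan x, as 1/tan^2 x = 1/sin^2 x - 1.  The additive
    error 1 becomes negligible after division by 4^n in [odd_basel_pow2]. *)
Lemma csc2_bounds x : 0 < x < pi / 2 -> x ^- 2 <= csc2 x <= x ^- 2 + 1.
Proof.
move=> /andP[x0 xp]; rewrite /csc2.
have s0 : 0 < sin x by apply: sin_gt0_pihalf; rewrite x0.
have c0 : 0 < cos x by apply: cos_gt0_pihalf; apply/andP; split; lra.
have h1 : sin x <= x by apply: sin_le_id; rewrite !ltW.
have h2 : x <= tan x by apply: id_le_tan; rewrite xp ltW.
apply/andP; split.
  by rewrite lef_pV2 ?posrE ?exprn_gt0// ler_pXn2r// ?nnegrE ltW.
have -> : (sin x ^+ 2)^-1 = (tan x ^+ 2)^-1 + 1.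
  rewrite -[LHS]mul1r -{1}(cos2Dsin2 x) /tan; field.
  by rewrite !gt_eqF.
rewrite lerD2r lef_pV2 ?posrE ?exprn_gt0//; last exact: lt_le_trans h2.
by rewrite ler_pXn2r// ?nnegrE ltW// (lt_le_trans x0).
Qed.

(** The odd multiples of pi/2^(n+2): for k < 2^n these are the angles in
    ]0, pi/2[ reached from pi/4 by n steps of x |-> x/2, pi/2 - x/2. *)
Definition odd_dyadic_angle n k : R := (2 * k + 1)%:R * pi / (2 ^ n.+2)%:R.

Lemma odd_dyadic_angle_itv n k : (k < 2 ^ n)%N ->
  0 < odd_dyadic_angle n k < pi / 2.
Proof.
move=> kn; rewrite /odd_dyadic_angle; apply/andP; split.
  by rewrite divr_gt0 ?mulr_gt0 ?pi_gt0 ?ltr0n//; lia.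
rewrite ltr_pdivrMr ?ltr0n ?expn_gt0// mulrC -mulrA ltr_pM2l ?pi_gt0//.
rewrite !expnS natrM mulKf// ltr_nat; lia.
Qed.

Lemma odd_dyadic_angle_half n k :
  odd_dyadic_angle n k / 2 = odd_dyadic_angle n.+1 k.
Proof.
rewrite /odd_dyadic_angle [in RHS]expnS natrM invfM; field.
by rewrite pnatr_eq0 -lt0n expn_gt0.
Qed.

Lemma odd_dyadic_angle_compl n k : (k < 2 ^ n.+1)%N ->
  odd_dyadic_angle n.+1 (2 ^ n.+1 - k.+1) = pi / 2 - odd_dyadic_angle n.+1 k.
Proof.
move=> kn; rewrite /odd_dyadic_angle.
have -> : (2 * (2 ^ n.+1 - k.+1) + 1)%:R = (2 ^ n.+2)%:R - (2 * k + 1)%:R :> R.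
  by apply/eqP; rewrite eq_sym subr_eq -natrD; apply/eqP; congr _%:R;
     rewrite (expnS _ n.+1); lia.
rewrite (expnS 2 n.+2) natrM; field.
by rewrite pnatr_eq0 -lt0n expn_gt0.
Qed.

(** Each step of [csc2_duplication] replaces an angle by its half and the
    complement of its half, and multiplies the sum by 4; the complements, listed
    in reverse order, are the second half of the next family of angles. *)
Lemma sum_csc2 n :
  \sum_(0 <= k < 2 ^ n) csc2 (odd_dyadic_angle n k) = 2 * 4 ^+ n.
Proof.
elim: n => [|n IH].
  rewrite big_nat1 mulr1 /csc2 /odd_dyadic_angle sin2cos2.
  have : cos (pi / 4 *+ 2) = 0 :> R.
    by rewrite -[RHS]cos_pihalf; congr cos; rewrite -mulr_natr; field.
  rewrite cos_mulr2n => h.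
  have -> : (2 * 0 + 1)%:R * pi / (2 ^ 2)%:R = pi / 4 :> R by rewrite mul1r.
  have -> : cos (pi / 4) ^+ 2 = 1 / 2 :> R by lra.
  by field.
have le2 : (2 ^ n <= 2 ^ n.+1)%N by rewrite leq_exp2l.
rewrite (@big_cat_nat _ _ _ (2 ^ n))//=.
have -> : \sum_(2 ^ n <= k < 2 ^ n.+1) csc2 (odd_dyadic_angle n.+1 k) =
    \sum_(0 <= k < 2 ^ n) csc2 (pi / 2 - odd_dyadic_angle n k / 2).
  rewrite -{1}(add0n (2 ^ n)%N) big_addn.
  have -> : (2 ^ n.+1 - 2 ^ n)%N = (2 ^ n)%N by rewrite expnS; lia.
  rewrite big_nat_rev/=; apply: eq_big_nat => k /andP[_ kn].
  rewrite odd_dyadic_angle_half -odd_dyadic_angle_compl ?(leq_trans kn)//.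
  by congr (csc2 (odd_dyadic_angle _ _)); rewrite expnS; lia.
rewrite -big_split/= exprS mulrCA -IH mulr_sumr.
apply: eq_big_nat => k /andP[_ kn].
rewrite (csc2_duplication (odd_dyadic_angle_itv kn)) [RHS]mulrC divfK//.
by rewrite odd_dyadic_angle_half.
Qed.

Definition odd_basel N : R := \sum_(1 <= n < N.+1 | odd n) n%:R ^- 2.

Lemma le_odd_basel M N : (M <= N)%N -> odd_basel M <= odd_basel N.
Proof.
move=> MN; rewrite /odd_basel (@big_cat_nat _ _ _ M.+1 1 N.+1)//= lerDl.
by apply: sumr_ge0 => k _; rewrite invr_ge0 exprn_ge0.
Qed.

Lemma sum_inv_sq_tail M N : (0 < M <= N)%N ->
  \sum_(M.+1 <= n < N.+1) n%:R ^- 2 <= M%:R^-1 :> R.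
Proof.
move=> /andP[M0 MN].
have : \sum_(M.+1 <= n < N.+1) n%:R ^- 2 <= M%:R^-1 - N%:R^-1 :> R.
  apply: (sum_le_telescope (f := fun n => n%:R ^- 2) (g := fun n => n%:R^-1)) => // n Mn.
  have n0 : 0 < n%:R :> R by rewrite ltr0n (leq_trans M0).
  rewrite -natr1.
  have -> : n%:R^-1 - (n%:R + 1)^-1 = (n%:R * (n%:R + 1))^-1 :> R.
    by field; rewrite !gt_eqF//; lra.
  rewrite lef_pV2 ?posrE ?exprn_gt0 ?mulr_gt0//; nra.
have : 0 <= N%:R^-1 :> R by rewrite invr_ge0.
lra.
Qed.

Lemma odd_basel_tail M N : (0 < M <= N)%N ->
  odd_basel N <= odd_basel M + M%:R^-1.
Proof.
move=> MN; have /andP[M0 MleN] := MN.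
rewrite /odd_basel (@big_cat_nat _ _ _ M.+1 1 N.+1)//= lerD2l.
apply: le_trans (sum_inv_sq_tail MN); rewrite big_mkcond/=.
by apply: ler_sum => i _; case: ifP => // _; rewrite invr_ge0 exprn_ge0.
Qed.

Lemma odd_baselE n :
  odd_basel (2 ^ n.+1) = \sum_(0 <= k < 2 ^ n) (2 * k + 1)%:R ^- 2.
Proof.
rewrite expnS; elim: (2 ^ n)%N => [|N IH]; first by rewrite /odd_basel !big_geq.
rewrite big_nat_recr//= -IH /odd_basel mulnS addSn add1n.
rewrite big_mkcond big_nat_recr//= big_nat_recr//= -big_mkcond/=.
by rewrite !oddM /= addr0 addn1.
Qed.

(** [csc2_bounds] summed over the 2^n angles of [sum_csc2]: the sum of their
    inverse squares is a multiple of [odd_basel], and lies within 2^n of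
    2 * 4^n. *)
Lemma odd_basel_pow2 n :
  odd_basel (2 ^ n.+1) <= pi ^+ 2 / 8
    <= odd_basel (2 ^ n.+1) + pi ^+ 2 / 16 / 2 ^+ n.
Proof.
rewrite odd_baselE.
set W := \sum_(_ <= _ < _) _.
have p0 : 0 < 2 ^+ n :> R by rewrite exprn_gt0.
have hE k : (odd_dyadic_angle n k) ^- 2 =
    16 * 4 ^+ n / pi ^+ 2 * (2 * k + 1)%:R ^- 2.
  rewrite /odd_dyadic_angle natrX !exprS.
  have -> : 4 ^+ n = 2 ^+ n * 2 ^+ n :> R by rewrite -exprMn -natrM.
  have : 0 < (2 * k + 1)%:R :> R by rewrite ltr0n addn1.
  move: (2 * k + 1)%:R pi (2 ^+ n) (@pi_gt0 R) p0 => c p q p_gt0 q0 c0; field.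
  by rewrite !gt_eqF.
have E : 16 * 4 ^+ n / pi ^+ 2 * W = \sum_(0 <= k < 2 ^ n) (odd_dyadic_angle n k) ^- 2.
  by rewrite /W mulr_sumr; apply: eq_bigr => k _; rewrite hE.
have lo : 16 * 4 ^+ n / pi ^+ 2 * W <= 2 * 4 ^+ n.
  rewrite E -sum_csc2; apply: ler_sum_nat => k /andP[_ kn].
  by have /andP[] := csc2_bounds (odd_dyadic_angle_itv kn).
have hi : 2 * 4 ^+ n <= 16 * 4 ^+ n / pi ^+ 2 * W + 2 ^+ n.
  have -> : 2 ^+ n = \sum_(0 <= k < 2 ^ n) 1 :> R.
    by rewrite sumr_const_nat subn0 natrX.
  rewrite E -sum_csc2 -big_split/=; apply: ler_sum_nat => k /andP[_ kn].
  by have /andP[] := csc2_bounds (odd_dyadic_angle_itv kn).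
have pp : 0 < (pi : R) ^+ 2 by rewrite exprn_gt0// pi_gt0.
have e4 : 4 ^+ n = 2 ^+ n * 2 ^+ n :> R by rewrite -exprMn -natrM.
have q0 : 0 < 4 ^+ n :> R by rewrite exprn_gt0.
apply/andP; split.
  rewrite -(ler_pM2l (x := 16 * 4 ^+ n / pi ^+ 2)); last by rewrite divr_gt0// mulr_gt0.
  apply: (le_trans lo); rewrite le_eqVlt; apply/orP; left; apply/eqP.
  by move: pi (@pi_gt0 R) => p p_gt0; field; rewrite gt_eqF.
rewrite -(ler_pM2l (x := 16 * 4 ^+ n / pi ^+ 2)); last by rewrite divr_gt0// mulr_gt0.
rewrite mulrDr [X in _ <= _ + X](_ : _ = 2 ^+ n); last first.
  rewrite e4; move: pi (@pi_gt0 R) (2 ^+ n) p0 => p p_gt0 q ?.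
  by field; rewrite !gt_eqF.
apply: le_trans hi; rewrite le_eqVlt; apply/orP; left; apply/eqP.
by move: pi (@pi_gt0 R) => p p_gt0; field; rewrite gt_eqF.
Qed.

(** The sum of the inverse squares of the odd integers is pi^2/8, with the error
    term of its partial sums. *)
Lemma odd_basel_bounds N : (0 < N)%N ->
  odd_basel N <= pi ^+ 2 / 8 <= odd_basel N + N%:R^-1.
Proof.
move=> N0; have lt2n n : (n < 2 ^ n.+1)%N.
  by apply: leq_trans (ltn_expl n (isT : 1 < 2)%N) _; rewrite leq_exp2l.
apply/andP; split.
  have /andP[+ _] := odd_basel_pow2 N; apply: le_trans.
  by rewrite le_odd_basel// ltnW.
apply/ler_addgt0Pr => e e0.
have [t ht] : exists t, pi ^+ 2 / 16 / e < t%:R :> R.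
  by eexists; exact: truncnS_gt.
pose m := (N + t)%N.
have /andP[_ H] := odd_basel_pow2 m.
apply: (le_trans H); apply: lerD.
  apply: odd_basel_tail; rewrite N0/= ltnW// (leq_ltn_trans _ (lt2n m))//.
  by rewrite leq_addr.
rewrite ler_pdivrMr ?exprn_gt0// -ler_pdivrMl// mulrC.
apply: (le_trans (ltW ht)); rewrite -natrX ler_nat.
by rewrite (leq_trans (leq_addl N t))// ltnW// ltn_expl.
Qed.

End OddBasel.

(** * Harmonic sums over the odd integers *)

Lemma sum_odd_even {V : nmodType} (f : nat -> V) N :
  \sum_(1 <= n < N.+1) f n =
  \sum_(1 <= n < N.+1 | odd n) f n + \sum_(1 <= m < (N %/ 2)%N.+1) f (2 * m)%N.
Proof.
rewrite (bigID odd)/=; congr (_ + _).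
rewrite -(sum_dvd_divn (fun m => f (2 * m)%N))//.
rewrite [LHS](eq_bigl (fun n => (2 %| n)%N)) => [|n]; last by rewrite dvdn2.
by apply: eq_bigr => n n2; rewrite mulnC divnK.
Qed.

Section Harmonic.
Variable R : realType.
Implicit Types (x y : R) (n M N k : nat).

Lemma truncn_ge1 x : 1 <= x -> [/\ (0 < Num.truncn x)%N, (Num.truncn x)%:R <= x,
  x < (Num.truncn x)%:R + 1 & x / 2 <= (Num.truncn x)%:R].
Proof.
move=> x1; have x0 : 0 <= x by lra.
have /andP[h1 h2] := truncn_itv x0.
have h3 : (0 < Num.truncn x)%N by rewrite truncn_gt0.
have h4 : 1 <= (Num.truncn x)%:R :> R by rewrite ler1n.
by rewrite -natr1 in h2; split => //; lra.
Qed.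

Lemma truncn_div x k : 0 <= x -> (0 < k)%N ->
  Num.truncn (x / k%:R) = (Num.truncn x %/ k)%N.
Proof.
move=> x0 k0; have /andP[h1 h2] := truncn_itv x0.
have k0' : 0 < k%:R :> R by rewrite ltr0n.
apply: truncn_def; rewrite ler_pdivlMr// ltr_pdivrMr// -!natrM.
apply/andP; split.
  by apply: le_trans h1; rewrite ler_nat leq_divM.
apply: (lt_le_trans h2); rewrite ler_nat.
exact: ltn_ceil.
Qed.

Definition harmonic_sum N : R := \sum_(1 <= k < N.+1) k%:R^-1.
Definition odd_harmonic_sum N : R := \sum_(1 <= k < N.+1 | odd k) k%:R^-1.

Lemma ln_natS_bounds n : (0 < n)%N ->
  n.+1%:R^-1 <= ln n.+1%:R - ln (n%:R : R) <= n%:R^-1.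
Proof.
move=> n0; have n0' : 0 < n%:R :> R by rewrite ltr0n.
have n1' : 0 < n.+1%:R :> R by rewrite ltr0n.
rewrite -ln_div ?posrE//; apply/andP; split.
  rewrite -[X in ln X]invrK lnV ?posrE ?invr_gt0 ?divr_gt0// invf_div lerNr.
  have -> : n%:R / n.+1%:R = 1 + - n.+1%:R^-1 :> R.
    by rewrite -natr1; field; rewrite natr1 gt_eqF.
  apply: le_ln1Dx; rewrite ltrN2 invf_lt1// ltr1n ltnS//.
have -> : n.+1%:R / n%:R = 1 + n%:R^-1 :> R by rewrite -natr1; field; rewrite gt_eqF.
by apply: le_ln1Dx; rewrite (lt_trans (ltrN10 _))// invr_gt0.
Qed.

(** Since 1/(n+1) <= ln (n+1) - ln n <= 1/n, the sequence H_n - ln n decreases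
    while H_n - ln n - 1/n increases. *)
Lemma harmonic_sum_ln_bounds M N : (0 < M <= N)%N ->
  harmonic_sum M - ln M%:R - M%:R^-1 + N%:R^-1 <= harmonic_sum N - ln N%:R
    <= harmonic_sum M - ln M%:R.
Proof.
move=> /andP[M0]; elim: N => [|N IH]; first by rewrite leqNgt M0.
rewrite leq_eqVlt ltnS => /predU1P[->|MN].
  by rewrite subrK lexx.
have /andP[h1 h2] := IH MN.
have /andP[h3 h4] := @ln_natS_bounds N (leq_trans M0 MN).
have -> : harmonic_sum N.+1 = harmonic_sum N + N.+1%:R^-1.
  by rewrite /harmonic_sum big_nat_recr.
move: (N.+1%:R^-1) (ln N.+1%:R) h3 h4 => a b h3 h4.
by apply/andP; split; lra.
Qed.

Lemma euler_gamma_bounds N : (0 < N)%N ->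
  euler_gamma <= harmonic_sum N - ln N%:R <= euler_gamma + N%:R^-1.
Proof.
move=> N0; pose u n : R := harmonic_sum n - ln n%:R.
have cu : cvgn u.
  apply/cvg_ex; exists (limn (fun n => u n.+1)).
  rewrite -cvg_shiftS; apply: nonincreasing_is_cvgn.
    by move=> m n mn; have /andP[] := @harmonic_sum_ln_bounds m.+1 n.+1 mn.
  exists (u 1%N - 1) => _ [n _ <-].
  have /andP[+ _] := @harmonic_sum_ln_bounds 1 n.+1 isT.
  have : 0 <= n.+1%:R^-1 :> R by rewrite invr_ge0.
  rewrite /u invr1 /=.
  move: (n.+1%:R^-1) (harmonic_sum n.+1 - _) => a b; lra.
have E : euler_gamma = limn u by [].
apply/andP; split.
  rewrite E; apply: limr_le => //; exists N => // n /= Nn.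
  by have /andP[] := @harmonic_sum_ln_bounds N n (introT andP (conj N0 Nn)).
rewrite -lerBlDr E; apply: limr_ge => //; exists N => // n /= Nn.
have /andP[+ _] := @harmonic_sum_ln_bounds N n (introT andP (conj N0 Nn)).
have : 0 <= n%:R^-1 :> R by rewrite invr_ge0.
rewrite /u; lra.
Qed.

Lemma ln_truncn x : 1 <= x ->
  0 <= ln x - ln (Num.truncn x)%:R <= (Num.truncn x)%:R^-1.
Proof.
move=> x1; have [N0 Nx xN _] := truncn_ge1 x1.
set N := Num.truncn x in N0 Nx xN *.
have N0' : 0 < N%:R :> R by rewrite ltr0n.
have x0 : 0 < x by lra.
rewrite subr_ge0 ler_ln ?posrE// Nx/= -ln_div ?posrE//.
have -> : x / N%:R = 1 + (x - N%:R) / N%:R by field; rewrite gt_eqF.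
apply: (@le_trans _ _ ((x - N%:R) / N%:R)).
  apply: le_ln1Dx; rewrite (lt_le_trans (ltrN10 _))// divr_ge0 ?subr_ge0 ?(ltW N0')//.
by rewrite ler_pdivrMr// mulVf ?gt_eqF//; lra.
Qed.

Lemma invf_truncn x : 1 <= x -> (Num.truncn x)%:R^-1 <= 2 / x.
Proof.
move=> x1; have [N0 _ _ h] := truncn_ge1 x1.
have N0' : 0 < (Num.truncn x)%:R :> R by rewrite ltr0n.
have x0 : 0 < x by lra.
by rewrite -[leRHS]invf_div lef_pV2 ?posrE ?divr_gt0.
Qed.

Lemma harmonic_sum_asymp x : 1 <= x ->
  `|harmonic_sum (Num.truncn x) - (ln x + euler_gamma)| <= 2 / x.
Proof.
move=> x1; have [N0 _ _ _] := truncn_ge1 x1.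
have /andP[h1 h2] := euler_gamma_bounds N0.
have /andP[h3 h4] := ln_truncn x1.
have h5 := invf_truncn x1.
rewrite ler_norml; apply/andP; split; lra.
Qed.

Lemma odd_harmonic_sumE N :
  odd_harmonic_sum N = harmonic_sum N - harmonic_sum (N %/ 2)%N / 2.
Proof.
rewrite {1}/harmonic_sum sum_odd_even -/(odd_harmonic_sum N).
apply/esym/eqP; rewrite subr_eq; apply/eqP; congr (_ + _).
by rewrite /harmonic_sum mulr_suml; apply: eq_bigr => m _; rewrite natrM invfM mulrC.
Qed.

Lemma euler_gamma_itv : 0 <= (euler_gamma : R) <= 1.
Proof.
have /andP[] := @euler_gamma_bounds 1 isT.
rewrite /harmonic_sum big_nat1 ln1 invr1 => h1 h2.
by apply/andP; split; lra.
Qed.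

(** The even terms of H_N add up to half of H_(N/2), whence the extra ln 2 / 2.
    When x < 2 there are no even terms and the estimate is checked by hand. *)
Lemma odd_harmonic_sum_asymp x : 1 <= x ->
  `|odd_harmonic_sum (Num.truncn x) - (ln x / 2 + euler_gamma / 2 + ln 2 / 2)|
    <= 4 / x.
Proof.
move=> x1; have x0 : 0 < x by lra.
have ln21 : ln 2 <= 1 :> R by rewrite [2]/(1 + 1); apply: le_ln1Dx; lra.
have ln20 : 0 <= ln 2 :> R by apply: ln_ge0; lra.
have [x2|x2] := ltP x 2.
  have -> : Num.truncn x = 1%N by apply: truncn_def; rewrite x1 x2.
  rewrite /odd_harmonic_sum big_mkcond big_nat1/= invr1.
  have h1 : 0 <= ln x by apply: ln_ge0.
  have h2 : ln x <= ln 2 by rewrite ler_ln ?posrE// ltW.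
  have /andP[h3 h4] := euler_gamma_itv.
  have h5 : 2 <= 4 / x by rewrite ler_pdivlMr//; lra.
  rewrite ler_norml; apply/andP; split; lra.
have h1 := harmonic_sum_asymp x1.
have x21 : 1 <= x / 2%:R by lra.
have := harmonic_sum_asymp x21; rewrite (truncn_div (ltW x0) (isT : (0 < 2)%N)) => h2.
rewrite ln_div ?posrE// in h2.
have e : 2 / (x / 2) = 4 / x by field; rewrite gt_eqF.
rewrite e in h2.
rewrite odd_harmonic_sumE; move: h1 h2; rewrite !ler_norml.
have e2 : 2 / x = (4 / x) / 2 by field; rewrite gt_eqF.
move=> /andP[h1 h2] /andP[h3 h4]; apply/andP; split; lra.
Qed.

End Harmonic.

(** * The derivative of zeta at 2 *)

Section ZetaDerivative.
Variable R : realType.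
Implicit Types (x y h u : R) (n M N k : nat).

Lemma cvgn_sum_ge0 (f : nat -> R) B : (forall k, 0 <= f k) ->
  (forall N, \sum_(1 <= k < N.+1) f k <= B) ->
  cvgn (fun N => \sum_(1 <= k < N.+1) f k).
Proof.
move=> f0 fB; apply: nondecreasing_is_cvgn.
  move=> M N MN; rewrite (@big_cat_nat _ _ _ M.+1 1 N.+1)//= lerDl.
  by apply: sumr_ge0.
by exists B => _ [n _ <-].
Qed.

(** With a and b the square roots of n and n+1, 1/a - 1/b = 1/(a b (a + b)) and
    a b (a + b) <= 2 b^3. *)
Lemma inv_mul_sqrt_telescope n : (0 < n)%N ->
  (n.+1%:R * Num.sqrt n.+1%:R)^-1 <=
  2 / Num.sqrt n%:R - 2 / Num.sqrt n.+1%:R :> R.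
Proof.
move=> n0; set a := Num.sqrt n%:R; set b := Num.sqrt n.+1%:R.
have a0 : 0 < a by rewrite sqrtr_gt0 ltr0n.
have b0 : 0 < b by rewrite sqrtr_gt0 ltr0n.
have e1 : n.+1%:R = b ^+ 2 :> R by rewrite sqr_sqrtr.
have e2 : b ^+ 2 = a ^+ 2 + 1 by rewrite !sqr_sqrtr// natr1.
rewrite e1 -subr_ge0.
have -> : 2 / a - 2 / b - (b ^+ 2 * b)^-1 = (2 * b ^+ 2 * (b - a) - a) / (a * b ^+ 3).
  by field; rewrite !gt_eqF.
apply: divr_ge0; last by rewrite mulr_ge0 ?exprn_ge0// ltW.
have ab : a < b by rewrite -(ltr_pXn2r (n := 2))// ?nnegrE ?ltW// e2; lra.
rewrite -(pmulr_lge0 _ (addr_gt0 a0 b0)).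
have -> : (2 * b ^+ 2 * (b - a) - a) * (a + b) =
    2 * b ^+ 2 * (b ^+ 2 - a ^+ 2) - a * (a + b) by ring.
rewrite {2}e2; nra.
Qed.

Lemma sum_inv_mul_sqrt_tail M N : (0 < M <= N)%N ->
  \sum_(M.+1 <= n < N.+1) (n%:R * Num.sqrt n%:R)^-1 <= 2 / Num.sqrt M%:R :> R.
Proof.
move=> /andP[M0 MN].
have := sum_le_telescope (f := fun n => (n%:R * Num.sqrt n%:R)^-1)
  (g := fun n => 2 / Num.sqrt n%:R : R) MN.
have h : 0 <= 2 / Num.sqrt N%:R :> R by rewrite divr_ge0.
move=> /(_ (fun n Mn => inv_mul_sqrt_telescope (leq_trans M0 Mn))); lra.
Qed.

Lemma sum_inv_mul_sqrt_le N :
  \sum_(1 <= n < N.+1) (n%:R * Num.sqrt n%:R)^-1 <= 3 :> R.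
Proof.
case: N => [|N]; first by rewrite big_geq.
rewrite big_ltn// sqrtr1 mulr1 invr1.
by have := @sum_inv_mul_sqrt_tail 1 N.+1 isT; rewrite sqrtr1 divr1; lra.
Qed.

(** From 1 + u <= exp u and 1 - u <= exp (-u), the remainder is at most
    u (exp u - 1), which is at most u^2 exp u if u >= 0 and u^2 otherwise. *)
Lemma expR_taylor1 u : `|expR u - 1 - u| <= u ^+ 2 * expR `|u|.
Proof.
have h1 := expR_ge1Dx u; rewrite ger0_norm; last by lra.
have h2 : expR u * (1 - u) <= 1.
  by rewrite -[leRHS](expRxMexpNx_1 u) ler_wpM2l ?expR_ge0// expR_ge1Dx.
apply: (@le_trans _ _ (u * (expR u - 1))); first by lra.
have [u0|u0] := leP 0 u.
  have : 0 <= u * (1 - expR u * (1 - u)) by rewrite mulr_ge0// subr_ge0.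
  by rewrite ger0_norm//; lra.
rewrite ltr0_norm//.
have f1 : 1 <= expR (- u) by rewrite -expR0 ler_expR; lra.
have : 0 <= u ^+ 2 * (expR (- u) - 1) by rewrite mulr_ge0 ?sqr_ge0// subr_ge0.
have : 0 <= - u * (expR u - 1 - u) by rewrite mulr_ge0//; lra.
lra.
Qed.

Lemma expR_three_halves_ln k : (0 < k)%N ->
  expR (- (3 / 2) * ln k%:R) = (k%:R * Num.sqrt k%:R)^-1 :> R.
Proof.
move=> k0; have k0' : 0 < k%:R :> R by rewrite ltr0n.
rewrite mulNr expRN -powR12_sqrt// /powR gt_eqF//.
have -> : 3 / 2 * ln k%:R = ln k%:R + 2^-1 * ln k%:R :> R by field.
by rewrite expRD lnK.
Qed.

Lemma ln_le_sqrt x : 0 < x -> ln x <= 2 * Num.sqrt x.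
Proof.
move=> x0; rewrite -{1}(sqr_sqrtr (ltW x0)) lnXn ?sqrtr_gt0//.
have : ln (Num.sqrt x) < Num.sqrt x by rewrite ln_sublinear ?sqrtr_gt0.
lra.
Qed.

Lemma ln_div_sq_le k : (0 < k)%N ->
  ln k%:R / k%:R ^+ 2 <= 2 * (k%:R * Num.sqrt k%:R)^-1 :> R.
Proof.
move=> k0; have k0' : 0 < k%:R :> R by rewrite ltr0n.
have s0 : 0 < Num.sqrt k%:R :> R by rewrite sqrtr_gt0.
have := ln_le_sqrt k0'; rewrite -(ler_pM2r (x := (k%:R ^+ 2)^-1)) ?invr_gt0 ?exprn_gt0//.
move=> /le_trans; apply; rewrite le_eqVlt; apply/orP; left; apply/eqP.
rewrite -{2 3}(sqr_sqrtr (ltW k0')); field.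
by rewrite gt_eqF.
Qed.

Definition inv_sq_sum N : R := \sum_(1 <= k < N.+1) k%:R ^- 2.
Definition ln_inv_sq_sum N : R := \sum_(1 <= k < N.+1) ln k%:R / k%:R ^+ 2.
Definition ln_inv_sq_series : R := limn ln_inv_sq_sum.

Lemma ln_inv_sq_ge0 k : 0 <= ln k%:R / k%:R ^+ 2 :> R.
Proof.
case: k => [|k]; first by rewrite expr0n/= invr0 mulr0.
by rewrite divr_ge0 ?exprn_ge0// ln_ge0// ler1n.
Qed.

Lemma ln_inv_sq_sum_tail M N : (0 < M <= N)%N ->
  ln_inv_sq_sum M <= ln_inv_sq_sum N <= ln_inv_sq_sum M + 4 / Num.sqrt M%:R.
Proof.
move=> /andP[M0 MN]; rewrite /ln_inv_sq_sum (@big_cat_nat _ _ _ M.+1 1 N.+1)//=.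
rewrite lerDl lerD2l; apply/andP; split.
  by apply: sumr_ge0 => k _; exact: ln_inv_sq_ge0.
have -> : 4 / Num.sqrt M%:R = 2 * (2 / Num.sqrt M%:R) :> R by ring.
apply: (@le_trans _ _ (\sum_(M.+1 <= k < N.+1) 2 * (k%:R * Num.sqrt k%:R)^-1)).
  by apply: ler_sum_nat => k /andP[Mk _]; apply: ln_div_sq_le; apply: leq_trans Mk.
by rewrite -mulr_sumr ler_pM2l// sum_inv_mul_sqrt_tail// M0.
Qed.

Lemma cvgn_ln_inv_sq_sum : cvgn ln_inv_sq_sum.
Proof.
apply: (@cvgn_sum_ge0 _ 4); first exact: ln_inv_sq_ge0.
case=> [|N]; first by rewrite big_geq.
have /andP[_] := @ln_inv_sq_sum_tail 1 N.+1 isT.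
by rewrite {2}/ln_inv_sq_sum big_nat1 ln1 mul0r add0r sqrtr1 divr1.
Qed.

Lemma ln_inv_sq_sum_bounds N : (0 < N)%N ->
  ln_inv_sq_sum N <= ln_inv_sq_series <= ln_inv_sq_sum N + 4 / Num.sqrt N%:R.
Proof.
move=> N0; apply/andP; split.
  apply: limr_ge; first exact: cvgn_ln_inv_sq_sum.
  exists N => // n /= Nn.
  by have /andP[] := @ln_inv_sq_sum_tail N n (introT andP (conj N0 Nn)).
apply: limr_le; first exact: cvgn_ln_inv_sq_sum.
exists N => // n /= Nn.
by have /andP[] := @ln_inv_sq_sum_tail N n (introT andP (conj N0 Nn)).
Qed.

Lemma cvgn_zeta x : 3 / 2 <= x ->
  cvgn (fun n : nat => \sum_(1 <= k < n.+1) k%:R `^ (- x)).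
Proof.
move=> x32; apply: (@cvgn_sum_ge0 _ 3) => [k|N]; first exact: powR_ge0.
apply: le_trans (sum_inv_mul_sqrt_le N).
apply: ler_sum_nat => k /andP[k0 _].
rewrite -expR_three_halves_ln// /powR pnatr_eq0 eqn0Ngt k0 ler_expR.
by rewrite ler_wpM2r ?ln_ge0 ?ler1n//; lra.
Qed.

(** The first order expansion in h of k^(-(2+h)), with a remainder that is
    summable in k uniformly in h: the factor ln^2 k k^|h| coming from
    [expR_taylor1] is at most 64 k^(1/2). *)
Lemma zeta_term_taylor h k : `|h| <= 1 / 4 -> (0 < k)%N ->
  `|k%:R `^ (- (2 + h)) - k%:R `^ (- 2) + h * (ln k%:R / k%:R ^+ 2)| <=
  64 * h ^+ 2 * (k%:R * Num.sqrt k%:R)^-1.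
Proof.
move=> h4 k0; have k0' : 0 < k%:R :> R by rewrite ltr0n.
rewrite -expR_three_halves_ln// powR_invn//.
rewrite /powR gt_eqF//.
have -> : k%:R ^- 2 = expR (- 2 * ln k%:R) :> R.
  by rewrite mulNr expRN expRM_natl lnK.
have l0 : 0 <= ln k%:R :> R by rewrite ln_ge0 ?ler1n.
move: (ln k%:R) l0 => l l0.
have -> : - (2 + h) * l = - 2 * l + - (h * l) by ring.
rewrite expRD.
have -> : expR (- 2 * l) * expR (- (h * l)) - expR (- 2 * l) +
    h * (l * expR (- 2 * l)) =
    expR (- 2 * l) * (expR (- (h * l)) - 1 - (- (h * l))).
  by ring.
rewrite normrM (ger0_norm (expR_ge0 _)).
have := expR_taylor1 (- (h * l)).
move=> /(ler_wpM2l (expR_ge0 (- 2 * l)))/le_trans; apply.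
have -> : - (3 / 2) * l = - 2 * l + (l / 8 + l / 8) + l / 4 by field.
rewrite !expRD sqrrN exprMn normrN normrM (ger0_norm l0).
have h1 : expR (`|h| * l) <= expR (l / 4) by rewrite ler_expR; nra.
(* Here l = ln k, and l/8 <= exp (l/8) gives l^2 <= 64 exp (l/4). *)
have h2 : l / 8 <= expR (l / 8) by have := expR_ge1Dx (l / 8); lra.
have h3 : l ^+ 2 <= 64 * (expR (l / 8) * expR (l / 8)) by nra.
have := expR_ge0 (- 2 * l) => e1; have := expR_ge0 (`|h| * l) => e2.
have hh : 0 <= h ^+ 2 by exact: sqr_ge0.
apply: (@le_trans _ _ (expR (- 2 * l) * (h ^+ 2 *
    (64 * (expR (l / 8) * expR (l / 8))) * expR (l / 4)))).
  rewrite ler_wpM2l//; apply: ler_pM => //; first by rewrite mulr_ge0 ?sqr_ge0.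
  by rewrite ler_wpM2l.
rewrite le_eqVlt; apply/orP; left; apply/eqP; ring.
Qed.

(** The sum over k of [zeta_term_taylor]; 192 is 64 times the bound 3 on the sum
    of k^(-3/2). *)
Lemma zeta_taylor h : `|h| <= 1 / 4 ->
  `|zeta (2 + h) - zeta 2 + h * ln_inv_sq_series| <= 192 * h ^+ 2.
Proof.
move=> h4.
pose S N : R := \sum_(1 <= k < N.+1) k%:R `^ (- (2 + h)) -
  \sum_(1 <= k < N.+1) k%:R `^ (- 2) + h * ln_inv_sq_sum N.
have cS : S @ \oo --> zeta (2 + h) - zeta 2 + h * ln_inv_sq_series.
  apply: cvgD; [apply: cvgB; apply: cvgn_zeta|apply: cvgMr].
  - by move: h4; rewrite ler_norml => /andP[]; lra.
  - by lra.
  - exact: cvgn_ln_inv_sq_sum.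
apply: (cvgr_to_le (cvg_norm cS)); exists 0%N => // N _ /=.
rewrite /S /ln_inv_sq_sum mulr_sumr -sumrB -big_split/=.
apply: le_trans (ler_norm_sum _ _ _) _.
apply: (@le_trans _ _ (\sum_(1 <= k < N.+1)
  64 * h ^+ 2 * (k%:R * Num.sqrt k%:R)^-1)).
  by apply: ler_sum_nat => k /andP[k0 _]; exact: zeta_term_taylor.
rewrite -mulr_sumr; have := sum_inv_mul_sqrt_le N.
have := sqr_ge0 h; nra.
Qed.

Lemma derive1_zeta2 : derive1 (zeta : R -> R) 2 = - ln_inv_sq_series.
Proof.
apply: cvg_lim => //; apply/cvgrPdist_le => e e0.
near=> h.
have h0 : h != 0 by near: h; exact: nbhs_dnbhs_neq.
have h4 : `|h| <= 1 / 4.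
  near: h; apply: dnbhs0_le; lra.
have he : `|h| <= e / 192.
  near: h; apply: dnbhs0_le; lra.
have := zeta_taylor h4.
rewrite [_ *: _]/(_ * _) [h + 2]addrC.
have -> : - ln_inv_sq_series - h^-1 * (zeta (2 + h) - zeta 2) =
  - (h^-1 * (zeta (2 + h) - zeta 2 + h * ln_inv_sq_series)) by field.
rewrite normrN normrM normfV -ler_pdivlMl ?invr_gt0 ?normr_gt0// invrK.
move=> /le_trans; apply; rewrite -(real_normK (num_real h)).
have := normr_ge0 h; nra.
Unshelve. all: by end_near. Qed.

End ZetaDerivative.

(** * The series of ln k / k^2 over the odd integers *)

Section OddSeries.
Variable R : realType.
Implicit Types (x y : R) (n M N k : nat).

Lemma le_addr_divn (a b c : R) :
  (forall M, (0 < M)%N -> a <= b + c / M%:R) -> a <= b.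
Proof.
move=> H; apply/ler_addgt0Pr => e e0.
have c0 : 0 < `|c| + 1 by have := normr_ge0 c; lra.
have h := truncnS_gt ((`|c| + 1) / e).
apply: (le_trans (H _ (ltn0Sn (Num.truncn ((`|c| + 1) / e))))); rewrite lerD2l.
rewrite ler_pdivrMr ?ltr0n// mulrC -ler_pdivrMr//.
apply: le_trans (ltW h); rewrite ler_pM2r ?invr_gt0//.
by have := ler_norm c; lra.
Qed.

Lemma inv_sq_sum_bounds N : (0 < N)%N ->
  inv_sq_sum R N <= zeta 2 <= inv_sq_sum R N + N%:R^-1.
Proof.
have E : (fun n : nat => \sum_(1 <= k < n.+1) k%:R `^ (- 2)) = inv_sq_sum R.
  by apply/funext => n; apply: eq_bigr => k _; rewrite powR_invn.
have cv : cvgn (inv_sq_sum R) by rewrite -E; apply: cvgn_zeta; lra.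
move=> N0; rewrite /zeta E; apply/andP; split.
  apply: limr_ge => //; exists N => // n /= Nn.
  rewrite /inv_sq_sum (@big_cat_nat _ _ _ N.+1 1 n.+1)//= lerDl.
  by apply: sumr_ge0 => k _; rewrite invr_ge0 exprn_ge0.
apply: limr_le => //; exists N => // n /= Nn.
rewrite /inv_sq_sum (@big_cat_nat _ _ _ N.+1 1 n.+1)//= lerD2l.
by rewrite sum_inv_sq_tail// N0.
Qed.

Lemma inv_sq_sumE N :
  inv_sq_sum R N = odd_basel R N + inv_sq_sum R (N %/ 2)%N / 4.
Proof.
rewrite {1}/inv_sq_sum sum_odd_even; congr (_ + _).
rewrite /inv_sq_sum mulr_suml; apply: eq_bigr => m _.
by rewrite natrM exprMn invfM mulrC; congr (_ / _); ring.
Qed.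

(** The even terms of zeta(2) add up to a quarter of it, so that 3/4 zeta(2) is
    the sum over the odd integers. *)
Lemma zeta2E : zeta 2 = pi ^+ 2 / 6 :> R.
Proof.
have H M : (0 < M)%N -> `|3 / 4 * zeta 2 - pi ^+ 2 / 8| <= 1 / M%:R :> R.
  move=> M0; have M20 : (0 < 2 * M)%N by rewrite muln_gt0.
  have /andP[h1 h2] := inv_sq_sum_bounds M0.
  have /andP[h3 h4] := inv_sq_sum_bounds M20.
  have /andP[h5 h6] := odd_basel_bounds R M20.
  have := inv_sq_sumE (2 * M); rewrite mulKn// => e.
  have i0 : 0 < M%:R^-1 :> R by rewrite invr_gt0 ltr0n.
  have ei : (2 * M)%:R^-1 = M%:R^-1 / 2 :> R by rewrite natrM invfM mulrC.
  rewrite ei in h4 h6.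
  by rewrite ler_norml; apply/andP; split; lra.
have : `|3 / 4 * zeta 2 - pi ^+ 2 / 8| <= 0 :> R.
  by apply: (@le_addr_divn _ _ 1) => M /H; rewrite add0r.
rewrite normr_le0 => /eqP; lra.
Qed.

Definition odd_ln_sum N : R := \sum_(1 <= k < N.+1 | odd k) ln k%:R / k%:R ^+ 2.

(** The sum of ln k / k^2 over odd k (see [odd_ln_sum_bounds]): the even terms
    ln (2 m) / (4 m^2) have been subtracted from the full series. *)
Definition odd_ln_series : R :=
  3 / 4 * ln_inv_sq_series R - ln 2 * (pi ^+ 2 / 24).

Lemma odd_ln_sumE N : odd_ln_sum N = ln_inv_sq_sum R N -
  (ln 2 * inv_sq_sum R (N %/ 2)%N + ln_inv_sq_sum R (N %/ 2)%N) / 4.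
Proof.
rewrite {1}/ln_inv_sq_sum sum_odd_even -/(odd_ln_sum N).
apply/esym/eqP; rewrite subr_eq; apply/eqP; congr (_ + _).
rewrite /inv_sq_sum /ln_inv_sq_sum mulr_sumr -big_split/= mulr_suml.
apply: eq_big_nat => m /andP[m0 _].
have m0' : 0 < m%:R :> R by rewrite ltr0n.
rewrite natrM lnM ?posrE// exprMn; field.
by rewrite gt_eqF.
Qed.

(** The lower bound comes from the tail of the full series.  The upper bound
    comes from the tails of the even part, which start at N/2 >= 1; for N = 1
    it follows from the case N = 2, where the sum is the same. *)
Lemma odd_ln_sum_bounds N : (0 < N)%N ->
  `|odd_ln_sum N - odd_ln_series| <= 4 / Num.sqrt N%:R.
Proof.
have ln21 : ln 2 <= 1 :> R by rewrite [2]/(1 + 1); apply: le_ln1Dx; lra.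
have ln20 : 0 <= ln 2 :> R by apply: ln_ge0; lra.
have upper M : (1 < M)%N ->
    odd_ln_sum M <= odd_ln_series + 5 / 2 / Num.sqrt M%:R.
  move=> M1; have M0 : (0 < M)%N by exact: ltnW.
  have M20 : (0 < M %/ 2)%N by rewrite divn_gt0.
  have /andP[h1 h2] := ln_inv_sq_sum_bounds R M0.
  have /andP[h3 h4] := ln_inv_sq_sum_bounds R M20.
  have /andP[h5 h6] := inv_sq_sum_bounds M20.
  rewrite zeta2E in h5 h6.
  have s1 : 1 <= Num.sqrt (M %/ 2)%:R :> R.
    by rewrite -[leLHS]sqrtr1 ler_wsqrtr ?ler1n.
  have s2 : Num.sqrt M%:R <= 2 * Num.sqrt (M %/ 2)%:R :> R.
    have -> : 2 = Num.sqrt 4 :> R.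
      have -> : 4 = 2 ^+ 2 :> R by ring.
      by rewrite sqrtr_sqr ger0_norm.
    rewrite -sqrtrM// ler_wsqrtr// -natrM ler_nat.
    have := divn_eq M 2; have : (M %% 2 < 2)%N by rewrite ltn_mod.
    by move: M20; move: (M %/ 2)%N (M %% 2)%N => a b; lia.
  have M0' : 0 < Num.sqrt M%:R :> R by rewrite sqrtr_gt0 ltr0n.
  have i1 : (M %/ 2)%:R^-1 <= (Num.sqrt (M %/ 2)%:R)^-1 :> R.
    rewrite lef_pV2 ?posrE ?ltr0n//; last by lra.
    by rewrite -[leRHS]sqr_sqrtr// expr2; nra.
  have i2 : (Num.sqrt (M %/ 2)%:R)^-1 <= 2 / Num.sqrt M%:R :> R.
    by rewrite -[leRHS]invf_div lef_pV2 ?posrE ?divr_gt0//; lra.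
  have i3 : ln 2 * (pi ^+ 2 / 6) <= ln 2 * inv_sq_sum R (M %/ 2)%N + (M %/ 2)%:R^-1.
    have : 0 <= (M %/ 2)%:R^-1 :> R by rewrite invr_ge0.
    nra.
  rewrite odd_ln_sumE /odd_ln_series.
  move: (Num.sqrt M%:R)^-1 (Num.sqrt (M %/ 2)%:R)^-1 ((M %/ 2)%:R^-1)
    h1 h2 h3 h4 i1 i2 i3 => a b c.
  lra.
move=> N0; rewrite ler_distl; apply/andP; split.
  have /andP[h1 h2] := ln_inv_sq_sum_bounds R N0.
  rewrite odd_ln_sumE /odd_ln_series.
  have [h3 h4] : ln_inv_sq_sum R (N %/ 2)%N <= ln_inv_sq_series R /\
                 inv_sq_sum R (N %/ 2)%N <= pi ^+ 2 / 6.
    have [->|M20] := posnP (N %/ 2)%N.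
      rewrite /ln_inv_sq_sum /inv_sq_sum !big_geq//.
      rewrite divr_ge0 ?sqr_ge0//; split=> //.
      have /andP[+ _] := ln_inv_sq_sum_bounds R (isT : (0 < 1)%N).
      by rewrite /ln_inv_sq_sum big_nat1 ln1 mul0r.
    rewrite -zeta2E; have /andP[-> _] := ln_inv_sq_sum_bounds R M20.
    by have /andP[-> _] := inv_sq_sum_bounds M20.
  have : ln 2 * inv_sq_sum R (N %/ 2)%N <= ln 2 * (pi ^+ 2 / 6) by rewrite ler_wpM2l.
  move: (Num.sqrt N%:R)^-1 h2 => a h2; lra.
have s0 : 0 < (Num.sqrt N%:R)^-1 :> R by rewrite invr_gt0 sqrtr_gt0 ltr0n.
move: N0; rewrite leq_eqVlt => /predU1P[<-|N1]; last first.
  have := upper _ N1; lra.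
have e1 : odd_ln_sum 1 = 0.
  by rewrite /odd_ln_sum big_mkcond big_nat1/= ln1 mul0r.
have e2 : odd_ln_sum 2 = 0.
  by rewrite /odd_ln_sum big_mkcond big_nat_recr//= big_nat1/= ln1 mul0r addr0.
have := upper 2 isT; rewrite e1 e2 sqrtr1.
have : (Num.sqrt 2)^-1 <= 1 :> R.
  by rewrite invf_le1 ?sqrtr_gt0// -[leLHS]sqrtr1 ler_wsqrtr//; lra.
lra.
Qed.

End OddSeries.

(** * Recovering a function from the sum of its odd dilations *)

Section OddInversion.
Variable R : realType.
Implicit Types (x y : R) (n M N k : nat).

(** Convexity of t |-> t^(-3/2) on [n, n+2]: the value at the midpoint is at
    most the mean value, which is half the difference of 2 t^(-1/2).  With a, b, c
    the square roots of n, n+1, n+2, it amounts to a c <= b^2 and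
    a + c <= 2 b. *)
Lemma inv_mul_sqrt_odd_telescope n : (0 < n)%N ->
  (n.+1%:R * Num.sqrt n.+1%:R)^-1 <=
  (Num.sqrt n%:R)^-1 - (Num.sqrt n.+2%:R)^-1 :> R.
Proof.
move=> n0; set a := Num.sqrt n%:R; set b := Num.sqrt n.+1%:R.
set c := Num.sqrt n.+2%:R.
have a0 : 0 < a by rewrite sqrtr_gt0 ltr0n.
have b0 : 0 < b by rewrite sqrtr_gt0 ltr0n.
have c0 : 0 < c by rewrite sqrtr_gt0 ltr0n.
have e1 : n.+1%:R = b ^+ 2 :> R by rewrite sqr_sqrtr.
have e2 : b ^+ 2 = a ^+ 2 + 1 by rewrite !sqr_sqrtr// natr1.
have e3 : c ^+ 2 = b ^+ 2 + 1 by rewrite !sqr_sqrtr// natr1.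
have h1 : a * c <= b ^+ 2.
  rewrite -(ler_pXn2r (n := 2)) ?nnegrE ?mulr_ge0 ?exprn_ge0 ?ltW//.
  by rewrite exprMn e3 e2; nra.
have h2 : a + c <= 2 * b.
  rewrite -(ler_pXn2r (n := 2)) ?nnegrE ?addr_ge0 ?mulr_ge0 ?ltW//.
  by rewrite sqrrD e3 exprMn; nra.
rewrite e1 -subr_ge0.
have -> : a^-1 - c^-1 - (b ^+ 2 * b)^-1 =
    (2 * b ^+ 3 - (a * c) * (a + c)) / (a * c * (a + c) * b ^+ 3).
  have e4 : c - a = 2 / (a + c).
    have ac : a + c != 0 by rewrite gt_eqF// addr_gt0.
    apply: (mulIf ac); rewrite divfK//.
    by have : (c - a) * (a + c) = c ^+ 2 - a ^+ 2; [ring|lra].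
  have -> : a^-1 - c^-1 = (c - a) / (a * c) by field; rewrite !gt_eqF.
  by rewrite e4; field; rewrite !gt_eqF ?addr_gt0.
apply: divr_ge0; last by rewrite !mulr_ge0 ?addr_ge0 ?exprn_ge0// ltW.
rewrite subr_ge0; apply: (@le_trans _ _ (b ^+ 2 * (2 * b)));
  last by rewrite le_eqVlt; apply/orP; left; apply/eqP; ring.
by apply: ler_pM => //; rewrite ?mulr_ge0 ?addr_ge0// ltW.
Qed.

(** The telescoping sum starts at n = 2, hence the bound 1/sqrt 2 <= 3/4.  That
    it is smaller than 1 is what makes [odd_inversion_bound] work. *)
Lemma sum_odd_inv_mul_sqrt_le N :
  \sum_(2 <= k < N.+1 | odd k) (k%:R * Num.sqrt k%:R)^-1 <= 3 / 4 :> R.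
Proof.
have H M : \sum_(2 <= k < (2 * M).+2 | odd k) (k%:R * Num.sqrt k%:R)^-1 <=
    (Num.sqrt 2)^-1 - (Num.sqrt (2 * M).+2%:R)^-1 :> R.
  elim: M => [|M IH].
    by rewrite muln0 big_geq// subrr.
  rewrite mulnS big_mkcond/= 2?big_nat_recr//= -big_mkcond/= oddM/= addr0.
  apply: (le_trans (lerD IH (inv_mul_sqrt_odd_telescope (ltn0Sn _)))).
  by rewrite addrA subrK.
have s2 : (Num.sqrt 2)^-1 <= 3 / 4 :> R.
  rewrite -[leRHS]invrK lef_pV2 ?posrE ?sqrtr_gt0 ?invr_gt0//; try lra.
  rewrite -(ler_pXn2r (n := 2)) ?nnegrE ?sqrtr_ge0 ?invr_ge0//; try lra.
  by rewrite sqr_sqrtr//; lra.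
apply: (@le_trans _ _ (\sum_(2 <= k < (2 * N).+2 | odd k)
  (k%:R * Num.sqrt k%:R)^-1)); last first.
  have : 0 <= (Num.sqrt (2 * N).+2%:R)^-1 :> R by rewrite invr_ge0 sqrtr_ge0.
  by have := H N; lra.
case: N => [|N]; first by rewrite big_geq//; apply: sumr_ge0 => k _;
  rewrite invr_ge0 mulr_ge0 ?sqrtr_ge0.
rewrite [leRHS](@big_cat_nat _ _ _ N.+2)//=; last by lia.
rewrite lerDl; apply: sumr_ge0 => k _; rewrite invr_ge0 mulr_ge0 ?sqrtr_ge0//.
Qed.

Lemma mul_sqrt_div x k : 0 < x -> (0 < k)%N ->
  x / k%:R * Num.sqrt (x / k%:R) = x * Num.sqrt x * (k%:R * Num.sqrt k%:R)^-1.
Proof.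
move=> x0 k0; rewrite sqrtrM ?ltW// sqrtrV// invfM; ring.
Qed.

(** Isolate the term k = 1 of the sum.  By induction the other terms are bounded
    by 4 C (x/k)^(3/2), and these bounds add up to at most
    3/4 * 4 C x^(3/2) = 3 C x^(3/2); adding the hypothesis C x^(3/2) gives
    4 C x^(3/2) back. *)
Lemma odd_inversion_bound (E : R -> R) (C : R) :
  (forall x, 1 <= x ->
    `|\sum_(1 <= k < (Num.truncn x).+1 | odd k) E (x / k%:R)|
      <= C * (x * Num.sqrt x)) ->
  forall x, 1 <= x -> `|E x| <= 4 * C * (x * Num.sqrt x).
Proof.
move=> H.
have C0 : 0 <= C.
  by have := le_trans (normr_ge0 _) (H 1 (lexx _)); rewrite sqrtr1 !mulr1.
suff IH n x : 1 <= x -> (Num.truncn x < n)%N -> `|E x| <= 4 * C * (x * Num.sqrt x).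
  by move=> x x1; apply: (IH (Num.truncn x).+1).
elim: n x => [//|n IH] x x1 xn.
have x0 : 0 < x by lra.
have [N0 Nx _ _] := truncn_ge1 x1.
have := H x x1; rewrite big_ltn_cond//= divr1.
set rest := \sum_(2 <= k < _ | odd k) _ => h.
have hr : `|rest| <= 3 * C * (x * Num.sqrt x).
  apply: (le_trans (ler_norm_sum _ _ _)).
  apply: (@le_trans _ _ (\sum_(2 <= k < (Num.truncn x).+1 | odd k)
      4 * C * (x * Num.sqrt x) * (k%:R * Num.sqrt k%:R)^-1)).
    rewrite [leLHS]big_nat_cond [leRHS]big_nat_cond.
    apply: ler_sum => k /andP[/andP[k2 kN] _].
    have k0 : (0 < k)%N by exact: ltnW.
    rewrite -mulrA -mul_sqrt_div//; apply: IH.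
      rewrite ler_pdivlMr ?ltr0n// mul1r; apply: le_trans Nx.
      by rewrite ler_nat.
    rewrite truncn_div ?ltW//; apply: (@leq_trans (Num.truncn x)) => //.
    by rewrite ltn_Pdiv.
  rewrite -mulr_sumr.
  have := sum_odd_inv_mul_sqrt_le (Num.truncn x).
  have : 0 <= 4 * C * (x * Num.sqrt x) by rewrite !mulr_ge0 ?sqrtr_ge0// ltW.
  nra.
have -> : E x = (E x + rest) - rest by ring.
apply: (le_trans (ler_normB _ _)); lra.
Qed.

End OddInversion.

(** * Asymptotic expansions *)

Section Asymptotics.
Variable R : realType.
Implicit Types (x y : R) (n M N k : nat).

Lemma odd_sumE N : odd_sum R N = (uphalf N)%:R ^+ 2.
Proof.
elim: N => [|N IH]; first by rewrite /odd_sum big_geq// expr0n.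
rewrite /odd_sum big_mkcond big_nat_recr//= -big_mkcond -/(odd_sum R N) IH.
rewrite uphalf_half -natrX -!natrX.
have := odd_double_half N; case: (odd N) => /= e; rewrite ?addr0 ?add0n//.
rewrite -natrD; congr _%:R; rewrite -{2}e -!mulnn; lia.
Qed.

Lemma odd_sum_asymp x : 1 <= x ->
  `|odd_sum R (Num.truncn x) - x ^+ 2 / 4| <= x.
Proof.
move=> x1; have [N0 h1 h2 _] := truncn_ge1 x1; rewrite odd_sumE.
set N := Num.truncn x in N0 h1 h2 *.
have h3 : N%:R <= 2 * (uphalf N)%:R :> R.
  by rewrite -natrM ler_nat uphalf_half; have := odd_double_half N; lia.
have h4 : 2 * (uphalf N)%:R <= N%:R + 1 :> R.
  rewrite -natrM natr1 ler_nat uphalf_half; have := odd_double_half N.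
  by have := leq_b1 (odd N); lia.
rewrite ler_distl; apply/andP; split; nra.
Qed.

(** The hyperbola method at U = floor (sqrt x).  For odd a <= U, a times the sum
    of the odd b <= x/a is x^2/(4a) + O(x); summing over a gives x^2/4 times the
    odd harmonic sum up to U, with an error U x <= x^(3/2).  The corner square
    contributes (x/4)^2 up to O(x^(3/2)). *)
Lemma weighted_odd_sum_asymp x : 1 <= x ->
  `|\sum_(1 <= a < (Num.truncn x).+1 | odd a)
      a%:R * odd_sum R (Num.truncn x %/ a)%N
    - (x ^+ 2 / 8 * ln x + (euler_gamma / 4 + ln 2 / 4 - 1 / 16) * x ^+ 2)|
  <= 6 * (x * Num.sqrt x).
Proof.
move=> x1; have x0 : 0 < x by lra.
set r := Num.sqrt x.
have r0 : 0 < r by rewrite sqrtr_gt0.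
have rr : r ^+ 2 = x by rewrite sqr_sqrtr// ltW.
have r1 : 1 <= r by rewrite -sqrtr1 ler_wsqrtr.
have [U0 h1 h2 _] := truncn_ge1 r1.
set U := Num.truncn r in U0 h1 h2.
set N := Num.truncn x.
have UN : (U ^ 2 <= N)%N.
  by rewrite truncn_ge_nat ?(ltW x0)// natrX -rr ler_pXn2r ?nnegrE// ltW.
have NU : (N < U.+1 ^ 2)%N.
  by rewrite truncn_lt_nat ?(ltW x0)// natrX -natr1 -rr ltr_pXn2r ?nnegrE ?addr_ge0// ltW.
pose f a : R := if odd a then a%:R else 0.
have fS M : \sum_(1 <= b < M.+1) f b = odd_sum R M.
  by rewrite /odd_sum [RHS]big_mkcond.
have -> : \sum_(1 <= a < N.+1 | odd a) a%:R * odd_sum R (N %/ a)%N =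
   \sum_(1 <= a < N.+1) f a * (\sum_(1 <= b < (N %/ a)%N.+1) f b).
  rewrite big_mkcond/=; apply: eq_bigr => a _; rewrite fS /f.
  by case: ifP => // _; rewrite mul0r.
rewrite (sum_hyperbola f UN NU) fS.
set V := \sum_(1 <= a < U.+1) _.
have hV : `|V - x ^+ 2 / 4 * odd_harmonic_sum R U| <= x * r.
  have -> : V - x ^+ 2 / 4 * odd_harmonic_sum R U =
      \sum_(1 <= a < U.+1 | odd a)
        (a%:R * odd_sum R (N %/ a)%N - x ^+ 2 / 4 * a%:R^-1).
    rewrite sumrB -mulr_sumr; congr (_ - _).
    rewrite /V [RHS]big_mkcond/=; apply: eq_bigr => a _; rewrite fS /f.
    by case: ifP => // _; rewrite mul0r.
  apply: (le_trans (ler_norm_sum _ _ _)).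
  apply: (@le_trans _ _ (\sum_(1 <= a < U.+1) x)); last first.
    rewrite sumr_const_nat subn1/= -[leLHS]mulr_natr ler_wpM2l// ltW//.
  rewrite big_mkcond/=; apply: ler_sum_nat => a /andP[a0 aU].
  case: ifP => _; last exact: ltW.
  have a0' : 0 < a%:R :> R by rewrite ltr0n.
  have ar : a%:R <= r by apply: le_trans h1; rewrite ler_nat.
  have xa : 1 <= x / a%:R by rewrite ler_pdivlMr// mul1r -rr; nra.
  have := odd_sum_asymp xa; rewrite (truncn_div (ltW x0) a0) -/N => h.
  have -> : a%:R * odd_sum R (N %/ a)%N - x ^+ 2 / 4 / a%:R =
     a%:R * (odd_sum R (N %/ a)%N - (x / a%:R) ^+ 2 / 4).
    by field; rewrite gt_eqF.
  rewrite normrM (gtr0_norm a0').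
  apply: (le_trans (ler_wpM2l (ltW a0') h)).
  by rewrite mulrC divfK ?gt_eqF.
have hO := odd_harmonic_sum_asymp r1; rewrite -/U in hO.
have lr : ln x = 2 * ln r by rewrite -{1}rr lnXn// mulr_natl.
have {}hO : `|x ^+ 2 / 4 * odd_harmonic_sum R U -
     x ^+ 2 / 4 * (ln x / 4 + euler_gamma / 2 + ln 2 / 2)| <= x * r.
  rewrite -mulrBr normrM ger0_norm; last by rewrite divr_ge0// sqr_ge0.
  have -> : ln x / 4 = ln r / 2 by rewrite lr; field.
  apply: (le_trans (ler_wpM2l _ hO)); first by rewrite divr_ge0// sqr_ge0.
  by rewrite -rr le_eqVlt; apply/orP; left; apply/eqP; field; rewrite gt_eqF.
have hS := odd_sum_asymp r1; rewrite -/U rr in hS.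
have {}hS : `|odd_sum R U ^+ 2 - x ^+ 2 / 16| <= 3 / 2 * (x * r).
  have S0 : 0 <= odd_sum R U by rewrite odd_sumE sqr_ge0.
  move: hS; rewrite !ler_distl => /andP[hS1 hS2].
  have rx : r <= x by rewrite -rr; nra.
  have xr : r * r = x by rewrite -expr2.
  have hS3 : odd_sum R U ^+ 2 <= (x / 4 + r) ^+ 2.
    by rewrite ler_pXn2r ?nnegrE ?addr_ge0 ?divr_ge0// ltW.
  apply/andP; split; last by nra.
  have [hS4|hS4] := leP (x / 4 - r) 0; first by nra.
  have : (x / 4 - r) ^+ 2 <= odd_sum R U ^+ 2.
    by rewrite ler_pXn2r ?nnegrE// ?ltW//; lra.
  nra.
move: hV hO hS; rewrite !ler_distl => /andP[a1 a2] /andP[b1 b2] /andP[c1 c2].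
apply/andP; split; lra.
Qed.

Lemma sq_mul_ln_div_le x : 1 <= x ->
  x ^+ 2 * (ln x * (2 / x)) <= 4 * (x * Num.sqrt x).
Proof.
move=> x1; have x0 : 0 < x by lra.
have := ln_le_sqrt x0.
have -> : x ^+ 2 * (ln x * (2 / x)) = 2 * x * ln x by field; rewrite gt_eqF.
nra.
Qed.

(** As ln (x/k) = ln x - ln k, the sum is x^2 times a combination of the partial
    sums of 1/k^2 and ln k/k^2 over odd k <= x.  Their tails are O(1/x) and
    O(x^(-1/2)); the first is multiplied by ln x = O(x^(1/2)). *)
Lemma model_sum_asymp (al be x : R) : 1 <= x ->
  `|\sum_(1 <= k < (Num.truncn x).+1 | odd k)
      ((x / k%:R) ^+ 2 * (al * ln (x / k%:R) + be))
    - x ^+ 2 * ((al * ln x + be) * (pi ^+ 2 / 8) - al * odd_ln_series R)|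
  <= (12 * `|al| + 2 * `|be|) * (x * Num.sqrt x).
Proof.
move=> x1; have x0 : 0 < x by lra.
have [N0 h1 h2 h3] := truncn_ge1 x1; set N := Num.truncn x in N0 h1 h2 h3 *.
have -> : \sum_(1 <= k < N.+1 | odd k)
      ((x / k%:R) ^+ 2 * (al * ln (x / k%:R) + be)) =
   x ^+ 2 * ((al * ln x + be) * odd_basel R N - al * odd_ln_sum R N).
  rewrite mulrBr 3!mulr_sumr mulr_sumr -sumrB.
  rewrite [LHS]big_nat_cond [RHS]big_nat_cond; apply: eq_bigr => k /andP[/andP[k0 _] _].
  have k0' : 0 < k%:R :> R by rewrite ltr0n.
  by rewrite ln_div ?posrE//; field; rewrite gt_eqF.
have hb : `|odd_basel R N - pi ^+ 2 / 8| <= 2 / x.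
  have /andP[b1 b2] := odd_basel_bounds R N0.
  have := invf_truncn x1; rewrite -/N => b3.
  have : 0 < N%:R^-1 :> R by rewrite invr_gt0 ltr0n.
  by rewrite ler_distl; move=> ?; apply/andP; split; lra.
have s0 : 0 < Num.sqrt x by rewrite sqrtr_gt0.
have hl : `|odd_ln_sum R N - odd_ln_series R| <= 8 / Num.sqrt x.
  apply: (le_trans (odd_ln_sum_bounds R N0)).
  rewrite -[leRHS]invf_div -[leLHS]invf_div lef_pV2 ?posrE ?divr_gt0 ?sqrtr_gt0 ?ltr0n//.
  suff : Num.sqrt x <= 2 * Num.sqrt N%:R by lra.
  rewrite -(ler_pXn2r (n := 2)) ?nnegrE ?mulr_ge0 ?sqrtr_ge0// exprMn !sqr_sqrtr//; lra.
have -> : x ^+ 2 * ((al * ln x + be) * odd_basel R N - al * odd_ln_sum R N) -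
    x ^+ 2 * ((al * ln x + be) * (pi ^+ 2 / 8) - al * odd_ln_series R) =
  al * (x ^+ 2 * ln x * (odd_basel R N - pi ^+ 2 / 8)) +
  be * (x ^+ 2 * (odd_basel R N - pi ^+ 2 / 8)) -
  al * (x ^+ 2 * (odd_ln_sum R N - odd_ln_series R)) by ring.
have l0 : 0 <= ln x by exact: ln_ge0.
have x20 : 0 <= x ^+ 2 by exact: sqr_ge0.
have xs : x <= x * Num.sqrt x.
  by rewrite ler_peMr ?(ltW x0)// -[leLHS]sqrtr1 ler_wsqrtr.
have k1 : `|x ^+ 2 * ln x * (odd_basel R N - pi ^+ 2 / 8)| <= 4 * (x * Num.sqrt x).
  rewrite normrM (ger0_norm (mulr_ge0 x20 l0)).
  apply: (le_trans (ler_wpM2l (mulr_ge0 x20 l0) hb)).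
  by rewrite -mulrA sq_mul_ln_div_le.
have k2 : `|x ^+ 2 * (odd_basel R N - pi ^+ 2 / 8)| <= 2 * (x * Num.sqrt x).
  rewrite normrM ger0_norm//.
  apply: (le_trans (ler_wpM2l x20 hb)).
  have -> : x ^+ 2 * (2 / x) = 2 * x by field; rewrite gt_eqF.
  lra.
have k3 : `|x ^+ 2 * (odd_ln_sum R N - odd_ln_series R)| <= 8 * (x * Num.sqrt x).
  rewrite normrM ger0_norm//.
  apply: (le_trans (ler_wpM2l x20 hl)).
  move: (Num.sqrt x) s0 (sqr_sqrtr (ltW x0)) => s s0 <-.
  by rewrite le_eqVlt; apply/orP; left; apply/eqP; field; rewrite gt_eqF.
apply: (le_trans (ler_normB _ _)).
apply: (le_trans (lerD (ler_normD _ _) (lexx _))).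
rewrite !(normrM al) (normrM be).
have := ler_wpM2l (normr_ge0 al) k1.
have := ler_wpM2l (normr_ge0 be) k2.
have := ler_wpM2l (normr_ge0 al) k3.
lra.
Qed.

Definition pillai_const : R :=
  1 / (6 * pi ^+ 2) * (- (36 * derive1 zeta 2 / pi ^+ 2) +
    (12 * euler_gamma - 3 + 10 * ln 2)).

Definition pillai_main x : R := x ^+ 2 * ((pi ^+ 2)^-1 * ln x + pillai_const).

(** The model with the announced coefficients has, summed over odd dilations,
    the main term of [weighted_odd_sum_asymp]. *)
Lemma pillai_main_const x :
  x ^+ 2 * (((pi ^+ 2)^-1 * ln x + pillai_const) * (pi ^+ 2 / 8)
    - (pi ^+ 2)^-1 * odd_ln_series R) =
  x ^+ 2 / 8 * ln x + (euler_gamma / 4 + ln 2 / 4 - 1 / 16) * x ^+ 2.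
Proof.
rewrite /pillai_const /odd_ln_series derive1_zeta2.
move: pi (@pi_gt0 R) => p p0; field.
by rewrite gt_eqF.
Qed.

Lemma pillai_sum_asymp : exists2 C : R, 0 <= C &
  forall x, 1 <= x ->
  `|pillai_sum R (Num.truncn x) - pillai_main x| <= C * (x * Num.sqrt x).
Proof.
pose C := 6 + (12 * `|(pi ^+ 2)^-1| + 2 * `|pillai_const|) : R.
have C0 : 0 <= C by rewrite !addr_ge0 ?mulr_ge0.
exists (4 * C); first by rewrite mulr_ge0.
apply: (odd_inversion_bound
  (E := fun x => pillai_sum R (Num.truncn x) - pillai_main x)).
move=> x x1; rewrite sumrB.
have -> : \sum_(1 <= k < (Num.truncn x).+1 | odd k)
    pillai_sum R (Num.truncn (x / k%:R)) =
  \sum_(1 <= k < (Num.truncn x).+1 | odd k) pillai_sum R (Num.truncn x %/ k)%N.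
  rewrite [LHS]big_nat_cond [RHS]big_nat_cond; apply: eq_bigr => k /andP[/andP[k0 _] _].
  by rewrite truncn_div//; lra.
rewrite sum_pillai_sum.
have := weighted_odd_sum_asymp x1.
have := model_sum_asymp (pi ^+ 2)^-1 pillai_const x1.
rewrite pillai_main_const !ler_distl /C /pillai_main => /andP[a1 a2] /andP[b1 b2].
by apply/andP; split; lra.
Qed.

Lemma pillai_main_pred : exists2 C : R, 0 <= C & forall x, 2 <= x ->
  `|pillai_main x - pillai_main (x - 1)| <= C * (x * Num.sqrt x).
Proof.
exists (5 * `|(pi ^+ 2)^-1| + 2 * `|pillai_const|).
  by rewrite addr_ge0 ?mulr_ge0.
move=> x x2; have x0 : 0 < x by lra.
have y0 : 0 < x - 1 by lra.
have xs : x <= x * Num.sqrt x.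
  by rewrite ler_peMr ?(ltW x0)// -[leLHS]sqrtr1 ler_wsqrtr//; lra.
have -> : pillai_main x - pillai_main (x - 1) =
  (pi ^+ 2)^-1 * ((2 * x - 1) * ln x + (x - 1) ^+ 2 * (ln x - ln (x - 1))) +
  pillai_const * (2 * x - 1) by rewrite /pillai_main; ring.
apply: (le_trans (ler_normD _ _)).
rewrite (normrM (pi ^+ 2)^-1) (normrM pillai_const).
rewrite [leRHS](_ : _ = `|(pi ^+ 2)^-1| * (5 * (x * Num.sqrt x)) +
  `|pillai_const| * (2 * (x * Num.sqrt x))); last by ring.
apply: lerD; rewrite ler_wpM2l//; last by rewrite ger0_norm; lra.
have l0 : 0 <= ln x by apply: ln_ge0; lra.
have d0 : 0 <= ln x - ln (x - 1) by rewrite subr_ge0 ler_ln ?posrE//; lra.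
have d1 : ln x - ln (x - 1) <= (x - 1)^-1.
  rewrite -ln_div ?posrE//.
  have -> : x / (x - 1) = 1 + (x - 1)^-1 by field; rewrite gt_eqF.
  by apply: le_ln1Dx; rewrite (lt_trans (ltrN10 _))// invr_gt0.
have d2 : (x - 1) ^+ 2 * (ln x - ln (x - 1)) <= x - 1.
  apply: (le_trans (ler_wpM2l (sqr_ge0 _) d1)).
  by rewrite expr2 mulfK// gt_eqF.
have d3 := ln_le_sqrt x0.
have d4 : 0 <= (x - 1) ^+ 2 * (ln x - ln (x - 1)) by rewrite mulr_ge0 ?sqr_ge0.
rewrite ger0_norm; nra.
Qed.

(** Halving the last term keeps the sum between those with and without it. *)
Lemma primed_pillai_bounds x : 2 <= x ->
  pillai_sum R (Num.truncn (x - 1)) <=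
  primed_sum (fun n => (a_seq n)%:R) x <= pillai_sum R (Num.truncn x).
Proof.
move=> x2; have x0 : 0 <= x by lra.
have [N0 Nx xN _] := @truncn_ge1 R x ltac:(lra).
have eN : Num.truncn (x - 1) = (Num.truncn x).-1.
  apply: truncn_def; move: N0 Nx xN; case: (Num.truncn x) => // N _ /=.
  by rewrite -!natr1 => ? ?; apply/andP; split; lra.
rewrite eN /primed_sum /pillai_sum prednK//; apply/andP; split; last first.
  by apply: ler_sum => n _; case: ifP => // _; rewrite ler_pdivrMr// ler_peMr// ler1n.
rewrite (@big_cat_nat _ _ _ (Num.truncn x) 1 (Num.truncn x).+1)//= big_nat1.
apply: ler_wpDr.
  by case: ifP => // _; rewrite divr_ge0.
apply: ler_sum_nat => n /andP[_ nN]; rewrite ifF//.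
by apply/negbTE; rewrite lt_eqF//; apply: lt_le_trans Nx; rewrite ltr_nat.
Qed.

End Asymptotics.

Unset Implicit Arguments.

Theorem theorem5p1 (R : realType) (eps : R)
    (heps : 134 / 1000 < eps < 1 / 2) :
  let A : R := 12 * euler_gamma - 3 + 10 * ln 2 in
  (fun x : R => primed_sum (fun n => (a_seq n)%:R) x) =
  (fun x : R => x ^+ 2 / pi ^+ 2 * ln x
     + 1 / (6 * pi ^+ 2) * (- (36 * derive1 zeta 2 / pi ^+ 2) + A) * x ^+ 2)
    +O_ (+oo_R) (fun x : R => x `^ (3 / 2 + eps) * ln x ^+ 2).
Proof.
move=> A; apply/eqaddOP.
have [C C0 HC] := pillai_sum_asymp R.
have [D D0 HD] := pillai_main_pred R.
near=> K; near=> x.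
have K0 : C + D <= K by near: K; apply: nbhs_pinfty_ge; exact: num_real.
have x2 : 2 <= x by near: x; apply: nbhs_pinfty_ge; exact: num_real.
have xe : expR 1 <= x by near: x; apply: nbhs_pinfty_ge; exact: num_real.
have x0 : 0 < x by lra.
have -> : ((fun x : R => primed_sum (fun n => (a_seq n)%:R) x) -
    (fun x : R => x ^+ 2 / pi ^+ 2 * ln x
     + 1 / (6 * pi ^+ 2) * (- (36 * derive1 zeta 2 / pi ^+ 2) + A) * x ^+ 2)) x =
    primed_sum (fun n => (a_seq n)%:R) x - pillai_main x.
  rewrite /pillai_main /pillai_const -/A fctE.
  by congr (_ - _); ring.
(* The threshold exp 1 on x serves to have ln x >= 1. *)
have l1 : 1 <= ln x by rewrite -(expRK 1) ler_ln ?posrE ?expR_gt0.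
have bound : x * Num.sqrt x <= x `^ (3 / 2 + eps) * ln x ^+ 2.
  have -> : x * Num.sqrt x = x `^ (3 / 2).
    rewrite -powR12_sqrt ?(ltW x0)// -{1}(powRr1 (ltW x0)) -powRD.
      by congr (_ `^ _); field.
    by apply/implyP => _; rewrite gt_eqF.
  have eps0 : 3 / 2 <= 3 / 2 + eps by lra.
  have := ler_powR (_ : 1 <= x) eps0 => /(_ ltac:(lra)) h.
  apply: (le_trans h); rewrite ler_peMr ?powR_ge0//.
  by rewrite exprn_ege1.
have xs0 : 0 <= x * Num.sqrt x by rewrite mulr_ge0 ?sqrtr_ge0// ltW.
rewrite (@ger0_norm _ (x `^ _ * _)); last by rewrite mulr_ge0 ?powR_ge0 ?sqr_ge0.
apply: (@le_trans _ _ ((C + D) * (x * Num.sqrt x))); last first.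
  by apply: ler_pM => //; rewrite addr_ge0.
have x1 : 1 <= x by lra.
have y1 : 1 <= x - 1 by lra.
have ys : (x - 1) * Num.sqrt (x - 1) <= x * Num.sqrt x.
  by apply: ler_pM; rewrite ?sqrtr_ge0 ?ler_wsqrtr//; lra.
have h1 := HC x x1; have h2 := HC (x - 1) y1; have h3 := HD x x2.
have {}h2 := le_trans h2 (ler_wpM2l C0 ys).
have /andP[p1 p2] := primed_pillai_bounds x2.
have Dx : 0 <= D * (x * Num.sqrt x) by rewrite mulr_ge0.
move: h1 h2 h3; rewrite !ler_distl => /andP[a1 a2] /andP[b1 b2] /andP[c1 c2].
by apply/andP; split; lra.
Unshelve. all: by end_near. Qed.
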